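(* Let $a,b\in\mathbb{R}$ with $|a|\ge 1$ and $b\neq0$, and consider the scalar system $x_{t+1}=ax_t+bu_t+w_t$, $t\ge 0$, where $\{w_t\}_{t\ge 0}$ is i.i.d., zero-mean, with $\sigma^2=E[w_0^2]<\infty$, and $w_0$ has a probability density with respect to Lebesgue measure that is positive everywhere on $\mathbb{R}$. Suppose that $E[|w_0|^\beta]<\infty$ for some $\beta>2$, and that $x_0$ is independent of $\{w_t\}_{t\ge 0}$ with $E[|x_0|^\beta]<\infty$. Then for every $\varepsilon\in(0,\beta-2)$ there exists a joint coding and control scheme (that is, for every sufficiently large channel capacity $C$, a causal zero-delay fixed-rate encoder and controller for the noiseless channel of capacity $C$ bits) such that, as $C\to\infty$, $$\limsup_{T\to\infty}\frac1T E\Big[\sum_{t=0}^{T-1}x_t^2\Big]-\sigma^2=O\!\left(\frac{2^{\frac{4}{\beta-\varepsilon}C}}{2^{2C}}\right).$$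
   Context: The discrete noiseless channel of capacity $C$ bits has a finite alphabet $\mathcal M$ with $|\mathcal M|=\lfloor 2^C\rfloor$. A joint coding and control scheme for capacity $C$ consists of: an encoder, i.e. a sequence of measurable maps $\eta_t:\mathcal M^{t}\times\mathbb{R}^{t+1}\to\mathcal M$, $t\ge0$, which at time $t$ transmits $q_t=\eta_t(q_0,\dots,q_{t-1},x_0,\dots,x_t)$; and a controller, i.e. a sequence of maps $\gamma_t:\mathcal M^{t+1}\to\mathbb{R}$, $t\ge 0$, which applies $u_t=\gamma_t(q_0,\dots,q_t)$. The symbol $q_t$ is received without error or delay. For nonnegative functions $f,g$ of $C$, $f=O(g)$ as $C\to\infty$ means that there is a constant $c>0$ with $f(C)\le c\,g(C)$ for all sufficiently large $C$. *)

(* Defs.v *)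
From mathcomp Require Export all_boot all_order all_algebra.
From mathcomp Require Export finmap.
From mathcomp Require Export all_classical all_reals all_analysis.

Set Implicit Arguments.
Unset Strict Implicit.
Unset Printing Implicit Defensive.

Import Order.TTheory GRing.Theory Num.Theory.
Import numFieldNormedType.Exports.

Local Open Scope classical_set_scope.
Local Open Scope ring_scope.

Section Probability.
Context {d : measure_display} {T : measurableType d} {R : realType}.
Variable P : probability T R.

Definition mutually_independent (I : choiceType) (X : I -> {RV P >-> R}) : Prop :=
  forall (J : {fset I}) (B : I -> set R),
    (forall i, measurable (B i)) ->
    P (\bigcap_(i in [set` J]) (X i @^-1` B i)) =
      (\prod_(i <- J) P (X i @^-1` B i))%E.

Definition identically_distributed (I : Type) (X : I -> {RV P >-> R}) : Prop :=
  forall (i j : I) (B : set R), measurable B ->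
    distribution P (X i) B = distribution P (X j) B.

Definition iid (I : choiceType) (X : I -> {RV P >-> R}) : Prop :=
  mutually_independent X /\ identically_distributed X.

Definition sigma_RV (X : {RV P >-> R}) : set (set T) :=
  preimage_set_system [set: T] X measurable.

Definition sigma_process (I : Type) (X : I -> {RV P >-> R}) : set (set T) :=
  <<s \bigcup_i sigma_RV (X i) >>.

Definition independent_of_process (Y : {RV P >-> R}) (I : Type)
    (X : I -> {RV P >-> R}) : Prop :=
  forall A B : set T, sigma_RV Y A -> sigma_process X B ->
    P (A `&` B) = (P A * P B)%E.

Definition has_positive_density (X : {RV P >-> R}) : Prop :=
  exists f : R -> R, [/\ measurable_fun [set: R] f, (forall x, 0 < f x) &
    forall B : set R, measurable B ->
      distribution P X B = (\int[lebesgue_measure]_(x in B) (f x)%:E)%E].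

End Probability.

Definition alphabet_size (R : realType) (C : R) : nat := Num.truncn (2 `^ C).

(* The product sigma-algebra on M^t x R^(t+1), with M = 'I_m discrete. It is
   spelled out because 'I_m, which is empty for m = 0, is not a pointedType and
   hence cannot be a measurableType. *)
Definition encoder_sigma_algebra (R : realType) (m t : nat) :
    set (set (t.-tuple 'I_m * t.+1.-tuple R)) :=
  <<s [set A `*` B | A in [set: set (t.-tuple 'I_m)]
                   & B in (measurable : set (set (t.+1.-tuple R)))] >>.

(* [enc t q y] is the symbol sent at time t when the symbols sent before are
   q = (q_0, ..., q_{t-1}) and the states observed so far are
   y = (x_0, ..., x_t). *)
Record scheme (R : realType) (m : nat) := Scheme {
  enc : forall t : nat, t.-tuple 'I_m -> t.+1.-tuple R -> 'I_m ;
  ctrl : forall t : nat, t.+1.-tuple 'I_m -> R ;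
  measurable_enc : forall (t : nat) (D : set 'I_m),
    @encoder_sigma_algebra R m t ((fun p => enc p.1 p.2) @^-1` D) }.

Section ClosedLoop.
Context {R : realType} {m : nat}.
Variables (a b : R) (S : scheme R m) (x0 : R) (w : nat -> R).

(* The pair ((q_0, ..., q_{t-1}), (x_0, ..., x_t)). *)
Fixpoint history (t : nat) : t.-tuple 'I_m * t.+1.-tuple R :=
  match t with
  | 0 => ([tuple], [tuple x0])
  | t'.+1 =>
      let: (q, x) := history t' in
      let q' := [tuple of rcons q (enc S q x)] in
      let u := ctrl S q' in
      (q', [tuple of rcons x (a * tnth x ord_max + b * u + w t')])
  end.

Definition state (t : nat) : R := tnth (history t).2 ord_max.

End ClosedLoop.

Definition average_cost d (T : measurableType d) (R : realType)
    (P : probability T R) (a b : R) (x0 : {RV P >-> R})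
    (w : nat -> {RV P >-> R}) (m : nat) (S : scheme R m) : \bar R :=
  limn_esup (fun n : nat => ((n%:R^-1)%:E *
    'E_P[(fun omega => (\sum_(t < n)
            state a b S (x0 omega) (fun k => w k omega) t ^+ 2)%R)])%E).

(* f = O(g) as C -> +oo, for nonnegative f and g, with f defined on
   [C0, +oo[ only: below capacity 0 the alphabet is empty and there is no
   scheme at all. *)
Definition bigO_pinfty (R : realType) (C0 : R)
    (f : forall C : R, C0 <= C -> \bar R) (g : R -> R) : Prop :=
  exists2 c : R, 0 < c &
    \forall C \near +oo, forall hC : C0 <= C, (f C hC <= (c * g C)%:E)%E.

(* Main.v *)
(** Quantize the state over an adaptive range [l] split into [k] equal cells,
    keeping one more symbol for overflow: shrink [l] towards a base range [l0]
    after a success, and multiply it by a large constant [K] after an overflow,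
    during which no control is applied. Cancelling the reconstructed state leaves
    [x' = a e + w], where [e] is the quantization error; as [e] depends on the past
    only, the excess cost is [a^2] times the mean of [e^2].

    With [p] the order of the moments, [energy x l = |x|^p l^(2-p) + weight * l^2],
    where [weight] is of order [k^-2], dominates [e^2] up to a constant factor, and
    it satisfies [energy' <= energy / 2 + forcing w] along every path. Hence the mean
    of [e^2] is at most of the order of the mean forcing [l0^(2-p) + l0^2 / k^2]. With
    [k] of order [2^C], the choice [l0 = 2^(2C/p)] makes both terms of order
    [2^(4C/p - 2C)]. *)

From HB Require Import structures.
Require Import Defs.
From mathcomp Require Import measurable_realfun ring lra.
Set Implicit Arguments.
Unset Strict Implicit.
Unset Printing Implicit Defensive.

Import Order.TTheory GRing.Theory Num.Theory.
Import numFieldNormedType.Exports.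

Local Open Scope classical_set_scope.
Local Open Scope ring_scope.

(** * The quantizer and its drift inequality *)

Section PowerInequalities.
Context {R : realType}.
Implicit Types (x y p s : R).

Lemma ler_normD_powR p x y : 0 <= p ->
  `|x + y| `^ p <= 2 `^ p * (`|x| `^ p + `|y| `^ p).
Proof.
move=> p0.
have Hmax z : `|x + y| <= 2 * z -> 0 <= z -> `|x + y| `^ p <= 2 `^ p * z `^ p.
  move=> h z0; rewrite -powRM//.
  by apply: ge0_ler_powR => //; rewrite nnegrE// mulr_ge0.
have xy := ler_normD x y.
have [le_xy|lt_yx] := leP `|x| `|y|.
- apply: le_trans (Hmax `|y| _ _) _ => //; first by lra.
  by rewrite ler_wpM2l ?powR_ge0// lerDr powR_ge0.
- apply: le_trans (Hmax `|x| _ _) _ => //; first by lra.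
  by rewrite ler_wpM2l ?powR_ge0// lerDl powR_ge0.
Qed.

Lemma ler_powR_nonpos x y s : 0 < x -> x <= y -> s <= 0 -> y `^ s <= x `^ s.
Proof.
move=> x0 xy s0; have y0 := lt_le_trans x0 xy.
rewrite -(opprK s) !(powRN _ (- s)) lef_pV2 ?posrE ?powR_gt0//.
by apply: ge0_ler_powR; rewrite ?oppr_ge0 ?nnegrE //; exact: ltW.
Qed.

Lemma powR_sqr x : 0 <= x -> x `^ 2 = x ^+ 2.
Proof. by move=> x0; rewrite -powR_mulrn. Qed.

(** The square splits as |x|^p |x|^(2-p), and the exponent 2-p is nonpositive. With [s] the range,
    this pays for overflow through the moment of order [p]. *)
Lemma sqr_le_moment p x s : 2 <= p -> 0 < s -> s <= `|x| ->
  x ^+ 2 <= `|x| `^ p * s `^ (2 - p).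
Proof.
move=> p2 s0 sx; have x0 := lt_le_trans s0 sx.
have -> : x ^+ 2 = `|x| `^ p * `|x| `^ (2 - p).
  rewrite -powRD; last by rewrite (gt_eqF x0) implybT.
  by rewrite (_ : p + (2 - p) = 2) ?powR_sqr// ?real_normK ?num_real//; ring.
by rewrite ler_wpM2l ?powR_ge0// ler_powR_nonpos//; lra.
Qed.

End PowerInequalities.

Section Quantizer.
Context {R : realType}.
Variable k : nat.
Implicit Types (l x : R) (j : nat).

Definition cell l x : nat :=
  if `|x| < l then Num.truncn ((x + l) / (2 * l) * k%:R) else k.

(** The reconstruction point is the left end of the cell, so the error may approach a full cell
    width. Overflow decodes to 0, which switches the control off. *)
Definition decode l j : R :=
  if (j < k)%N then l * (2 * j%:R / k%:R - 1) else 0.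

Lemma cell_overflow l x : l <= `|x| -> cell l x = k.
Proof. by rewrite /cell; case: ltP. Qed.

Lemma cell_lt l x : (0 < k)%N -> 0 < l -> `|x| < l -> (cell l x < k)%N.
Proof.
move=> k0 l0 xl; rewrite /cell xl; move: xl; rewrite ltr_norml => /andP[lx xl].
rewrite truncn_lt_nat; last first.
  by rewrite mulr_ge0// divr_ge0//; lra.
rewrite gtr_pMl ?ltr0n// ltr_pdivrMr; last by lra.
by lra.
Qed.

Lemma cell_leq l x : (0 < k)%N -> 0 < l -> (cell l x <= k)%N.
Proof.
move=> k0 l0; have [xl|lx] := ltP `|x| l; first exact/ltnW/cell_lt.
by rewrite cell_overflow.
Qed.

Lemma decode_error l x : (0 < k)%N -> 0 < l -> `|x| < l ->
  `|x - decode l (cell l x)| <= 2 * l / k%:R.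
Proof.
move=> k0 l0 xl; rewrite /decode cell_lt// /cell xl.
move: xl; rewrite ltr_norml => /andP[lx xl].
set y := (x + l) / (2 * l) * k%:R.
have kR : 0 < k%:R :> R by rewrite ltr0n.
have y0 : 0 <= y by rewrite mulr_ge0// divr_ge0//; lra.
have /andP[y1 y2] := truncn_itv y0.
(* The error is the fractional part of the cell coordinate [y] times the cell width. *)
have -> : x - l * (2 * (Num.truncn y)%:R / k%:R - 1) =
  (y - (Num.truncn y)%:R) * (2 * l / k%:R).
  by rewrite /y; field; rewrite ?gt_eqF.
rewrite normrM [X in _ * X]ger0_norm; last by rewrite divr_ge0//; lra.
rewrite ger_pMl ?divr_gt0//; last by lra.
move: y2; rewrite -natr1 => y2.
by rewrite ger0_norm; lra.
Qed.

Lemma decode_overflow l : decode l k = 0.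
Proof. by rewrite /decode ltnn. Qed.

End Quantizer.

Section Rescaling.
Context {R : realType}.
Variables (k : nat) (l0 K : R).
Implicit Types (x l : R).

(** Adding [l0] keeps the range above its base value, and the factor 1/4 makes the squared range
    contract with room to spare. *)
Definition rescale l (j : nat) : R :=
  if (j < k)%N then l0 + l / 4 else K * l.

Lemma rescale_ge l j : 0 < l0 -> 1 <= K -> l0 <= l -> l0 <= rescale l j.
Proof.
move=> l0_gt0 K1 l0l; rewrite /rescale; case: ifP => _; first by lra.
by apply: (le_trans l0l); rewrite ler_peMl//; lra.
Qed.

Definition residual x l : R := x - decode k l (cell k l x).

End Rescaling.

Section Drift.
Context {R : realType}.
Variables (k : nat) (a p l0 K : R).
Hypotheses (k0 : (0 < k)%N) (p2 : 2 <= p) (l0_gt0 : 0 < l0) (K1 : 1 <= K).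
Hypothesis a1 : 1 <= `|a|.

Local Ltac dlra := move: p2 l0_gt0 K1 a1; lra.

(** Homogeneous of degree 2 in [x] and [l] together, hence comparable with squared errors, and
    nonincreasing in the range when [2 <= p]. *)
Definition moment (x l : R) : R := `|x| `^ p * l `^ (2 - p).

(** The factors come from splitting off the noise, from the cell width amplified by [a], and from a
    range that may shrink to [l / 4]. *)
Definition granular_const : R := 2 `^ p * (2 * `|a|) `^ p * 4 `^ (p - 2).

(** The 4 makes the moment created by the quantization error at most a quarter of the range term
    [weight * l ^+ 2]. *)
Definition weight : R := 4 * granular_const / k%:R ^+ 2.

Definition energy (x l : R) : R := moment x l + weight * l ^+ 2.

Definition forcing (v : R) : R :=
  2 `^ p * moment v l0 + 2 * weight * l0 ^+ 2.

(* After an overflow, [K_large] makes the moment contract, and [k_large] makes the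
   cost [weight * (K * l) ^+ 2] of the enlarged range at most a quarter of it. *)
Hypothesis K_large : 2 `^ p * `|a| `^ p * K `^ (2 - p) <= 4^-1.
Hypothesis k_large : 16 * granular_const * K ^+ 2 <= k%:R ^+ 2.

Lemma granular_const_gt0 : 0 < granular_const.
Proof. by rewrite !mulr_gt0 ?powR_gt0//; move: a1; lra. Qed.

Let kR : 0 < k%:R ^+ 2 :> R.
Proof. by rewrite exprn_gt0// ltr0n. Qed.

Lemma weight_gt0 : 0 < weight.
Proof. by rewrite divr_gt0// mulr_gt0// granular_const_gt0. Qed.

Let weightK : weight * K ^+ 2 <= 4^-1.
Proof.
rewrite /weight mulrAC ler_pdivrMr//; move: k_large; lra.
Qed.

Lemma moment_ge0 x l : 0 <= moment x l.
Proof. by rewrite mulr_ge0// powR_ge0. Qed.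

Lemma energy_ge0 x l : 0 <= energy x l.
Proof. by rewrite addr_ge0 ?moment_ge0// mulr_ge0 ?sqr_ge0// ltW// weight_gt0. Qed.

Lemma forcing_ge0 v : 0 <= forcing v.
Proof.
have := weight_gt0; have := moment_ge0 v l0; have := powR_ge0 2 p; have := sqr_ge0 l0.
by move=> *; rewrite addr_ge0// mulr_ge0// mulr_ge0// ltW.
Qed.

(** The noise moment is taken at the base range, the worst case as [moment] decreases with the
    range; [forcing] then depends on the noise alone. *)
Let moment_step x v l : l0 <= l ->
  moment (x + v) l <= 2 `^ p * moment x l + 2 `^ p * moment v l0.
Proof.
move=> l0l; rewrite /moment.
apply: (@le_trans _ _ (2 `^ p * (`|x| `^ p + `|v| `^ p) * l `^ (2 - p))).
  by rewrite ler_wpM2r ?powR_ge0// ler_normD_powR//; dlra.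
rewrite mulrDr mulrDl -!mulrA lerD2l ler_wpM2l ?powR_ge0//.
by rewrite ler_wpM2l ?powR_ge0// ler_powR_nonpos//; dlra.
Qed.

(** The powers of [l] combine to [l ^+ 2], and k^(-p) is at most k^(-2) because [2 <= p]. *)
Let granular_moment e l l' : 0 < l -> `|e| <= 2 * l / k%:R -> l / 4 <= l' ->
  2 `^ p * moment (a * e) l' <= weight / 4 * l ^+ 2.
Proof.
move=> l_gt0 el ll'.
have k1 : 1 <= k%:R :> R by rewrite ler1n.
have kV : 0 <= k%:R^-1 :> R by rewrite invr_ge0; dlra.
have H1 : `|a * e| `^ p <= (2 * `|a|) `^ p * (l `^ p * k%:R `^ (- p)).
  have -> : k%:R `^ (- p) = k%:R^-1 `^ p :> R.
    by rewrite -powR_inv1 ?ler0n// -powRrM mulN1r.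
  have l_ge0 := ltW l_gt0.
  rewrite -!powRM ?mulr_ge0//.
  apply: ge0_ler_powR; rewrite ?nnegrE ?mulr_ge0//; first by dlra.
  rewrite normrM; apply: le_trans (ler_wpM2l _ el) _ => //.
  by rewrite le_eqVlt; apply/orP; left; apply/eqP; ring.
have H2 : l' `^ (2 - p) <= l `^ (2 - p) * 4 `^ (p - 2).
  apply: (@le_trans _ _ ((l / 4) `^ (2 - p))).
    by apply: ler_powR_nonpos => //; [rewrite divr_gt0|dlra].
  have <- : 4^-1 `^ (2 - p) = 4 `^ (p - 2) :> R.
    by rewrite -powR_inv1// -powRrM mulN1r opprB.
  by rewrite -powRM ?invr_ge0// ltW.
have H3 : k%:R `^ (- p) <= (k%:R ^+ 2)^-1 :> R.
  rewrite powRN lef_pV2 ?posrE ?powR_gt0//; last by dlra.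
  by rewrite -powR_sqr; [apply: ler_powR|dlra].
have H4 : l `^ p * l `^ (2 - p) = l ^+ 2.
  rewrite -powRD; last by rewrite (gt_eqF l_gt0) implybT.
  by rewrite -powR_sqr ?ltW//; congr (_ `^ _); ring.
rewrite /moment.
apply: (@le_trans _ _ (2 `^ p * (((2 * `|a|) `^ p * (l `^ p * k%:R `^ (- p))) *
   (l `^ (2 - p) * 4 `^ (p - 2))))).
  by rewrite ler_wpM2l ?powR_ge0// ler_pM ?powR_ge0.
rewrite [leLHS](_ : _ = granular_const * l ^+ 2 * k%:R `^ (- p)); last first.
  by rewrite -H4 /granular_const; ring.
rewrite [leRHS](_ : _ = granular_const * l ^+ 2 * (k%:R ^+ 2)^-1); last first.
  by rewrite /weight; field; dlra.
by rewrite ler_wpM2l// mulr_ge0 ?sqr_ge0// ltW// granular_const_gt0.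
Qed.

(** After a success, the quantization error and the shrunk range each cost a quarter of
    [weight * l ^+ 2], up to forcing. After an overflow, [l ^+ 2] is at most the moment, so the
    contracted moment and the enlarged range each cost a quarter of the moment. *)
Lemma energy_step x l v : l0 <= l ->
  energy (a * residual k x l + v) (rescale k l0 K l (cell k l x)) <=
    energy x l / 2 + forcing v.
Proof.
move=> l0l; have l_gt0 : 0 < l by dlra.
have := rescale_ge k (cell k l x) l0_gt0 K1 l0l.
have W0 := weight_gt0.
have M0 := moment_ge0 x l.
rewrite /residual; have [xl|lx] := ltP `|x| l.
- move=> H; rewrite {1}/energy; apply: (le_trans (lerD (moment_step _ _ H) (lexx _))).
  have := decode_error k0 l_gt0 xl.
  set e := x - _ => eE.
  have /(granular_moment l_gt0 eE) : l / 4 <= rescale k l0 K l (cell k l x).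
    by rewrite /rescale cell_lt//; dlra.
  rewrite /rescale cell_lt// /energy /forcing => G.
  have : weight * (l0 + l / 4) ^+ 2 <= weight * (2 * l0 ^+ 2 + l ^+ 2 / 4).
    by rewrite ler_wpM2l ?ltW//; have := sqr_ge0 (l0 - l / 4); nra.
  by nra.
- rewrite cell_overflow// decode_overflow subr0.
  have -> : rescale k l0 K l k = K * l by rewrite /rescale ltnn.
  move=> H.
  rewrite {1}/energy; apply: (le_trans (lerD (moment_step _ _ H) (lexx _))).
  have -> : 2 `^ p * moment (a * x) (K * l) =
     (2 `^ p * `|a| `^ p * K `^ (2 - p)) * moment x l.
    by rewrite /moment normrM !powRM//; [ring|dlra|dlra].
  have l2 : l ^+ 2 <= moment x l.
    apply: le_trans (sqr_le_moment _ _ lx) => //.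
    by rewrite -(real_normK (num_real x)) lerXn2r ?nnegrE//; dlra.
  have h1 := ler_wpM2r M0 K_large.
  have h2 : weight * (K * l) ^+ 2 <= 4^-1 * moment x l.
    rewrite exprMn mulrA; apply: ler_pM => //.
      by rewrite mulr_ge0 ?sqr_ge0// ltW.
    exact: sqr_ge0.
  have h3 : 0 <= weight * l0 ^+ 2 by rewrite mulr_ge0 ?sqr_ge0// ltW.
  have h4 : 0 <= weight * l ^+ 2 by rewrite mulr_ge0 ?sqr_ge0// ltW.
  by rewrite /energy /forcing; dlra.
Qed.

(** Without overflow the squared cell width is exactly [weight * l ^+ 2 / granular_const]; with
    overflow the residual is [x] itself, and [sqr_le_moment] applies. *)
Lemma sqr_residual_le x l : l0 <= l ->
  residual k x l ^+ 2 <= (1 + granular_const^-1) * energy x l.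
Proof.
move=> l0l; have l_gt0 : 0 < l by dlra.
have M0 := moment_ge0 x l; have C0 := granular_const_gt0.
have W0 := weight_gt0; have E0 := energy_ge0 x l.
have CV : 0 < granular_const^-1 by rewrite invr_gt0.
rewrite /residual; have [xl|lx] := ltP `|x| l.
- have := decode_error k0 l_gt0 xl; set e := x - _ => eE.
  have : e ^+ 2 <= granular_const^-1 * (weight * l ^+ 2).
    rewrite (_ : granular_const^-1 * _ = (2 * l / k%:R) ^+ 2); last first.
      by rewrite /weight; field; rewrite ?gt_eqF// ltr0n.
    rewrite -(real_normK (num_real e)) lerXn2r ?nnegrE// divr_ge0//; dlra.
  move=> h; apply: le_trans h _.
  rewrite mulrDl mul1r.
  have : granular_const^-1 * (weight * l ^+ 2) <= granular_const^-1 * energy x l.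
    by rewrite ler_wpM2l ?(ltW CV)// /energy lerDr.
  by dlra.
- rewrite cell_overflow// decode_overflow subr0.
  have h1 : x ^+ 2 <= moment x l by exact: sqr_le_moment.
  have h2 : moment x l <= energy x l.
    by rewrite /energy lerDl mulr_ge0 ?sqr_ge0// ltW.
  have : 0 <= granular_const^-1 * energy x l by rewrite mulr_ge0// ltW.
  by rewrite mulrDl; dlra.
Qed.

End Drift.

(** * Independence *)

Section ProductExpectation.
Context {d d1 d2 : measure_display} {T : measurableType d} {R : realType}.
Context {T1 : measurableType d1} {T2 : measurableType d2}.
Variable P : probability T R.
Local Open Scope ereal_scope.

Definition independent_pair (X : T -> T1) (Y : T -> T2) : Prop :=
  forall A B, measurable A -> measurable B ->
    P (X @^-1` A `&` Y @^-1` B) = P (X @^-1` A) * P (Y @^-1` B).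

(** Independence says that the law of the pair agrees with the product measure on rectangles;
    uniqueness of the product measure and Fubini conclude. *)
Lemma integral_independent_pair (X : {mfun T >-> T1}) (Y : {mfun T >-> T2})
    (f : T1 * T2 -> \bar R) :
  independent_pair X Y -> measurable_fun [set: T1 * T2] f ->
  P.-integrable [set: T] (fun t => f (X t, Y t)) ->
  \int[P]_t f (X t, Y t) =
    \int[distribution P X]_x \int[distribution P Y]_y f (x, y).
Proof.
move=> XY mf ifXY.
have mXY : measurable_fun [set: T] (fun t => (X t, Y t)).
  exact: measurable_fun_pair.
pose XY' : {mfun T >-> (T1 * T2)%type} :=
  HB.pack (fun t => (X t, Y t)) (isMeasurableFun.Build _ _ _ _ _ mXY).
pose mu := distribution P X.
pose nu := distribution P Y.
have muE A : measurable A -> (mu \x nu) A = pushforward P XY' A.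
  by move=> mA; apply: product_measure_unique => // B C; exact: XY.
have ipf : (pushforward P XY').-integrable [set: T1 * T2] f.
  by apply: integrable_pushforward => //; rewrite preimage_setT.
have if_ : (mu \x nu).-integrable [set: T1 * T2] f.
  apply/integrableP; split => //.
  move/integrableP : ipf => [_]; apply: le_lt_trans.
  by rewrite (eq_measure_integral (pushforward P XY'))// => A mA _; exact: muE.
transitivity (\int[pushforward P XY']_z f z).
  by rewrite integral_pushforward// preimage_setT.
transitivity (\int[mu \x nu]_z f z).
  by apply: eq_measure_integral => A mA _; exact/esym/muE.
by rewrite -integral12_prod_meas1.
Qed.

End ProductExpectation.

Section OrthogonalNoise.
Context {d : measure_display} {T : measurableType d} {R : realType}.
Variable P : probability T R.
Local Open Scope ereal_scope.

Lemma integral_mul_independent (X Y : {mfun T >-> R}) :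
  independent_pair P X Y ->
  P.-integrable [set: T] (EFin \o Y) -> \int[P]_t (Y t)%:E = 0 ->
  P.-integrable [set: T] (fun t => (X t * Y t)%:E) ->
  \int[P]_t (X t * Y t)%:E = 0.
Proof.
move=> XY iY EY iXY.
have mf : measurable_fun setT (fun z : R * R => (z.1 * z.2)%:E).
  by apply/measurable_EFinP; exact: measurable_funM.
rewrite (integral_independent_pair XY mf)//= integral0_eq// => x _.
under eq_integral do rewrite EFinM.
rewrite integralZl//; last first.
  by apply: integrable_pushforward => //; rewrite preimage_setT.
by rewrite integral_pushforward ?preimage_setT//= EY mule0.
Qed.

End OrthogonalNoise.

Section Past.
Context {d : measure_display} {T : measurableType d} {R : realType}.
Variables (P : probability T R) (x0 : {RV P >-> R}) (w : nat -> {RV P >-> R}).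

Definition below (n : nat) : {fset nat} := [fset i | i in iota 0 n]%fset.

Lemma in_below n i : (i \in below n) = (i < n)%N.
Proof. by rewrite !inE mem_iota add0n. Qed.

Lemma belowS n : below n.+1 = (n |` below n)%fset.
Proof.
by apply/fsetP => i; rewrite in_fset1U !in_below ltnS leq_eqVlt.
Qed.

(** A pi-system generating the sigma-algebra of [x0] and of the noises at times before [n]. *)
Definition past_rect (n : nat) : set (set T) :=
  [set S | exists A, exists B : nat -> set R, [/\ measurable A,
     forall i, measurable (B i) &
     S = x0 @^-1` A `&` \bigcap_(i in [set` below n]) w i @^-1` B i]].

Let mpre (X : {RV P >-> R}) A : measurable A -> measurable (X @^-1` A).
Proof. by move=> mA; rewrite -[X in measurable X]setTI; exact: measurable_funP. Qed.

Let mcap n (B : nat -> set R) : (forall i, measurable (B i)) ->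
  measurable (\bigcap_(i in [set` below n]) w i @^-1` B i).
Proof.
move=> mB; apply: fin_bigcap_measurable; first exact: finite_fset.
by move=> i _; exact: mpre.
Qed.

Lemma past_rect_measurable n : past_rect n `<=` measurable.
Proof.
by move=> _ [A [B [mA mB ->]]]; apply: measurableI; [exact: mpre|exact: mcap].
Qed.

Lemma past_rectI n : setI_closed (past_rect n).
Proof.
move=> _ _ [A [B [mA mB ->]]] [A' [B' [mA' mB' ->]]].
exists (A `&` A'), (fun i => B i `&` B' i); split.
- exact: measurableI.
- by move=> i; exact: measurableI.
- rewrite preimage_setI; under [in RHS]eq_bigcapr => i _ do rewrite preimage_setI.
  by rewrite bigcapI setIACA.
Qed.

Lemma past_rectT n : past_rect n setT.
Proof.
exists setT, (fun=> setT); split => //.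
by rewrite preimage_setT setTI bigcapT.
Qed.

Hypotheses (x0w : independent_of_process x0 w) (ww : mutually_independent w).

Local Open Scope ereal_scope.

Let sigma_cap n (B : nat -> set R) : (forall i, measurable (B i)) ->
  sigma_process w (\bigcap_(i in [set` below n]) w i @^-1` B i).
Proof.
move=> mB.
apply: (@fin_bigcap_measurable _ (g_sigma_algebraType (\bigcup_i sigma_RV (w i)))).
  exact: finite_fset.
move=> i _; apply: sub_sigma_algebra; exists i => //.
by exists (B i) => //; rewrite setTI.
Qed.

Lemma past_rect_independent n S B : past_rect n S -> measurable B ->
  P (S `&` w n @^-1` B) = P S * P (w n @^-1` B).
Proof.
move=> [A [C [mA mC ->]]] mB.
(* Placing [B] at index [n] turns the joint event into a rectangle over [below n.+1], to which both
   independence hypotheses apply. *)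
pose C' i := if i == n then B else C i.
have mC' i : measurable (C' i) by rewrite /C'; case: eqP.
have sA : sigma_RV x0 (x0 @^-1` A) by exists A => //; rewrite setTI.
have capE : \bigcap_(i in [set` below n]) w i @^-1` C i =
            \bigcap_(i in [set` below n]) w i @^-1` C' i.
  apply: eq_bigcapr => i /=; rewrite in_below /C'.
  by case: eqP => // ->; rewrite ltnn.
have capS : \bigcap_(i in [set` below n]) w i @^-1` C i `&` w n @^-1` B =
            \bigcap_(i in [set` below n.+1]) w i @^-1` C' i.
  rewrite capE belowS bigcap_fsetU1 setIC.
  by rewrite {2}/C' eqxx.
have nb : n \notin below n by rewrite in_below ltnn.
rewrite -setIA capS x0w//; last exact: sigma_cap.
rewrite x0w//; last exact: sigma_cap.
rewrite (ww _ mC') belowS big_fsetU1//= -(ww _ mC') -capE {1}/C' eqxx.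
by rewrite -muleA; congr *%E; rewrite muleC.
Qed.

(** For fixed [B], both sides are finite measures in [S] that agree on the pi-system [past_rect n],
    hence on the sigma-algebra it generates. *)
Lemma past_independent n S B : <<s past_rect n >> S -> measurable B ->
  P (S `&` w n @^-1` B) = P S * P (w n @^-1` B).
Proof.
move=> sS mB.
have mwB : measurable (w n @^-1` B) by exact: mpre.
have c0 : (0 <= fine (P (w n @^-1` B)))%R by exact: fine_ge0.
have Pfin : P (w n @^-1` B) \is a fin_num by exact: fin_num_measure.
pose m1 := mrestr P mwB.
pose m2 := mscale (NngNum c0) P.
suff : m1 S = m2 S.
  by rewrite /m1 /m2 /mrestr /mscale/= fineK// muleC.
apply: (g_sigma_algebra_measure_unique (past_rect n) _ (fun=> setT)) => //.
- exact: past_rect_measurable.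
- by move=> _; exact: past_rectT.
- by rewrite bigcup_const.
- exact: past_rectI.
- move=> A GA; rewrite /= /mrestr /mscale/= fineK// muleC.
  exact: past_rect_independent.
- move=> _; rewrite /= /mrestr setTI.
  by rewrite (le_lt_trans (probability_le1 _ _))// ltry.
Qed.

(** The sample space under the smaller sigma-algebra: dependence on the past only becomes ordinary
    measurability, with all its closure rules. *)
Definition past (n : nat) := g_sigma_algebraType (past_rect n).

Lemma past_measurable_init n : measurable_fun [set: past n] (x0 : past n -> R).
Proof.
move=> _ A mA; rewrite setTI; apply: sub_sigma_algebra.
exists A, (fun=> setT); split => //.
by rewrite bigcapT// setIT.
Qed.

Lemma past_measurable_noise n i : (i < n)%N ->
  measurable_fun [set: past n] (w i : past n -> R).
Proof.
move=> i_lt_n _ A mA; rewrite setTI; apply: sub_sigma_algebra.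
exists setT, (fun j => if j == i then A else setT); split => //.
  by move=> j; case: ifP.
rewrite preimage_setT setTI; apply/seteqP; split.
  by move=> t At j _ /=; case: ifP => // /eqP ->.
by move=> t /(_ i)/=; rewrite in_below eqxx; exact.
Qed.

Lemma past_measurable n (f : T -> R) :
  measurable_fun [set: past n] (f : past n -> R) -> measurable_fun [set: T] f.
Proof.
move=> mf _ A mA; have := mf measurableT A mA.
apply: smallest_sub; first exact: sigma_algebra_measurable.
exact: past_rect_measurable.
Qed.

Lemma past_independent_pair n (f : T -> R) :
  measurable_fun [set: past n] (f : past n -> R) ->
  independent_pair P f (w n).
Proof.
move=> mf A B mA mB; apply: past_independent => //.
by have := mf measurableT A mA; rewrite setTI.
Qed.

End Past.

(** * The zooming scheme *)

Section MeasurableQuantizer.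
Context {d : measure_display} {T : measurableType d} {R : realType}.
Variable k : nat.

(** Viewed as a real function, truncation is nondecreasing, hence measurable, and any set of
    naturals has a countable image in the reals. *)
Lemma measurable_truncn : measurable_fun [set: R] (@Num.truncn R).
Proof.
have mN : measurable_fun [set: R] (fun x : R => (Num.truncn x)%:R : R).
  apply: nondecreasing_measurable => // x y.
  by move=> *; rewrite ler_nat; exact: le_truncn.
move=> _ Y _; rewrite setTI.
have -> : @Num.truncn R @^-1` Y =
    (fun x : R => (Num.truncn x)%:R : R) @^-1` ((fun n => n%:R) @` Y).
  apply/seteqP; split => x /=; first by exists (Num.truncn x).
  by move=> [n Yn /eqP]; rewrite eqr_nat => /eqP <-.
rewrite -[X in measurable X]setTI; apply: mN => //.
apply: countable_measurable => //.
apply: (sub_countable (card_image_le _ Y)). exact: countableP.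
Qed.

Lemma measurable_cell (L X : T -> R) :
  measurable_fun [set: T] L -> measurable_fun [set: T] X ->
  measurable_fun [set: T] (fun t => cell k (L t) (X t)).
Proof.
move=> mL mX.
(* The library proves [powR] measurable, but not the inverse; the two agree here
   because [`|X t| < L t] forces [0 < L t]. *)
have -> : (fun t => cell k (L t) (X t)) = (fun t => if `|X t| < L t
    then Num.truncn ((X t + L t) * (2^-1 * L t `^ (-1)) * k%:R) else k).
  apply/funext => t; rewrite /cell; case: ltP => // XL.
  have L0 : 0 <= L t by rewrite (le_trans _ (ltW XL)).
  by rewrite powR_inv1// invfM.
apply: measurable_fun_ifT => //.
- by apply: measurable_fun_ltr => //; exact: measurableT_comp.
- apply: (measurableT_comp measurable_truncn).
  apply: measurable_funM => //; apply: measurable_funM.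
    exact: measurable_funD.
  apply: measurable_funM => //.
  exact: (measurableT_comp (measurable_powR _)).
Qed.

Lemma measurable_decode (L : T -> R) (j : T -> nat) :
  measurable_fun [set: T] L -> measurable_fun [set: T] j ->
  measurable_fun [set: T] (fun t => decode k (L t) (j t)).
Proof.
move=> mL mj; apply: measurable_fun_ifT => //.
  exact: measurable_fun_ltn.
apply: measurable_funM => //; apply: measurable_funB => //.
apply: measurable_funM => //; apply: measurable_funM => //.
by apply: (@measurableT_comp _ _ _ _ _ _ (fun n : nat => n%:R : R)) => // _ A _.
Qed.

Lemma measurable_rescale (l0 K : R) (L : T -> R) (j : T -> nat) :
  measurable_fun [set: T] L -> measurable_fun [set: T] j ->
  measurable_fun [set: T] (fun t => rescale k l0 K (L t) (j t)).
Proof.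
move=> mL mj; apply: measurable_fun_ifT.
- exact: measurable_fun_ltn.
- by apply: measurable_funD => //; exact: measurable_funM.
- exact: measurable_funM.
Qed.

Lemma measurable_residual (L X : T -> R) :
  measurable_fun [set: T] L -> measurable_fun [set: T] X ->
  measurable_fun [set: T] (fun t => residual k (X t) (L t)).
Proof.
move=> mL mX; apply: measurable_funB => //.
by apply: measurable_decode => //; exact: measurable_cell.
Qed.

End MeasurableQuantizer.

Section ZoomScheme.
Context {R : realType}.
Variables (k : nat) (a b l0 K : R).

(** The range is a function of the transmitted symbols alone, so encoder and controller stay
    synchronized without further communication. *)
Definition range_of (q : seq 'I_k.+1) : R :=
  foldl (fun l (j : 'I_k.+1) => rescale k l0 K l j) l0 q.

Definition zoom_enc (t : nat) (q : t.-tuple 'I_k.+1) (y : t.+1.-tuple R) :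
    'I_k.+1 :=
  inord (cell k (range_of q) (tnth y ord_max)).

(** The last symbol has to be decoded with the range in force when it was sent, hence [take t q]. *)
Definition zoom_ctrl (t : nat) (q : t.+1.-tuple 'I_k.+1) : R :=
  - (a / b) * decode k (range_of (take t q)) (tnth q ord_max).

Lemma measurable_zoom_enc (t : nat) (D : set 'I_k.+1) :
  @encoder_sigma_algebra R k.+1 t ((fun p => zoom_enc p.1 p.2) @^-1` D).
Proof.
(* Symbol histories are countable: the preimage is split along the history, and each piece is a
   rectangle. Codes of no history give [set0]. *)
pose F (n : nat) : set (t.-tuple 'I_k.+1 * t.+1.-tuple R) :=
  if (choice.unpickle n : option (t.-tuple 'I_k.+1)) is Some q
  then [set q]%classic `*` ((fun y => zoom_enc q y) @^-1` D) else set0.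
have -> : (fun p => zoom_enc p.1 p.2) @^-1` D = \bigcup_n F n.
  apply/seteqP; split => [[q y] /= Dqy|[q y] [n _]].
    by exists (choice.pickle q) => //; rewrite /F choice.pickleK.
  by rewrite /F; case: choice.unpickle => // q' [/= -> ].
have sA : sigma_algebra setT (@encoder_sigma_algebra R k.+1 t).
  exact: smallest_sigma_algebra.
case: sA => s0 _ sU; apply: sU => n; rewrite /F.
case: choice.unpickle => [q|//]; apply: sub_sigma_algebra.
exists [set q] => //; exists ((fun y => zoom_enc q y) @^-1` D) => //.
have mc : measurable_fun [set: t.+1.-tuple R]
    (fun y => cell k (range_of q) (tnth y ord_max)).
  by apply: measurable_cell => //; exact: measurable_tnth.
have := mc measurableT ((fun j => D (inord j)) : set nat) I.
by rewrite setTI.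
Qed.

Definition zoom : scheme R k.+1 :=
  Scheme zoom_ctrl measurable_zoom_enc.

Variables (x0 : R) (w : nat -> R).
Hypotheses (b0 : b != 0) (k0 : (0 < k)%N).
Hypotheses (l0_gt0 : 0 < l0) (K1 : 1 <= K).

Definition zoom_range t : R := range_of (history a b zoom x0 w t).1.

Local Notation x := (state a b zoom x0 w).
Local Notation l := zoom_range.

Lemma zoom_range0 : l 0 = l0.
Proof. by []. Qed.

Lemma zoom_state0 : x 0 = x0.
Proof. by rewrite /state /= (tnth_nth 0). Qed.

Let range_rcons q j : range_of (rcons q j) = rescale k l0 K (range_of q) j.
Proof. by rewrite /range_of foldl_rcons. Qed.

Lemma range_of_ge q : l0 <= range_of q.
Proof.
elim/last_ind: q => [//|q j IHq].
by rewrite range_rcons; exact: rescale_ge (l0_gt0) _ _.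
Qed.

Lemma zoom_range_ge t : l0 <= l t.
Proof. exact: range_of_ge. Qed.

Let symbolE t : (enc zoom (history a b zoom x0 w t).1 (history a b zoom x0 w t).2
  : nat) = cell k (l t) (x t).
Proof.
rewrite /= /zoom_enc inordK// ltnS.
apply: cell_leq => //; exact: lt_le_trans (range_of_ge _).
Qed.

Lemma zoom_rangeS t : l t.+1 = rescale k l0 K (l t) (cell k (l t) (x t)).
Proof.
rewrite -symbolE /zoom_range /=; case: (history _ _ _ _ _ t) => q y /=.
exact: range_rcons.
Qed.

(** The control contributes exactly [- a] times the decoded state, as [b] cancels. *)
Lemma zoom_stateS t : x t.+1 = a * residual k (x t) (l t) + w t.
Proof.
have := symbolE t; rewrite /residual.
rewrite /zoom_range /state /=; case: (history _ _ _ _ _ t) => q y /= <-.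
rewrite (tnth_nth 0) /= nth_rcons size_tuple ltnn eqxx; congr (_ + _).
rewrite /zoom_ctrl (tnth_nth ord0)/= nth_rcons size_tuple ltnn eqxx.
rewrite -cats1 take_size_cat ?size_tuple//.
by field.
Qed.

End ZoomScheme.

(** * Integrals *)

Section RealIntegrals.
Context {d : measure_display} {T : measurableType d} {R : realType}.
Variable P : probability T R.

Lemma le_integrable_EFin (f g : T -> R) : measurable_fun [set: T] f ->
  (forall t, `|f t| <= g t) -> P.-integrable [set: T] (EFin \o g) ->
  P.-integrable [set: T] (EFin \o f).
Proof.
move=> mf fg; apply: le_integrable => //; first exact/measurable_EFinP.
move=> t _; rewrite /= lee_fin; apply: le_trans (fg t) _; exact: ler_norm.
Qed.

Lemma integrable_EFin_sum (f : nat -> T -> R) n :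
  (forall i, P.-integrable [set: T] (EFin \o f i)) ->
  P.-integrable [set: T] (EFin \o (fun t => \sum_(i < n) f i t)).
Proof.
move=> fi.
rewrite (_ : _ \o _ = fun t => (\sum_(i < n) (f i t)%:E)%E).
  by apply: integrable_sum => // i _; exact: fi.
by apply/funext => t /=; rewrite sumEFin.
Qed.

Lemma integrable_EFinD (f g : T -> R) :
  P.-integrable [set: T] (EFin \o f) -> P.-integrable [set: T] (EFin \o g) ->
  P.-integrable [set: T] (EFin \o (fun t => f t + g t)).
Proof. by move=> fi gi; exact: (integrableD _ fi gi). Qed.

Lemma integrable_EFinZ (r : R) (f : T -> R) :
  P.-integrable [set: T] (EFin \o f) ->
  P.-integrable [set: T] (EFin \o (fun t => r * f t)).
Proof. by move=> fi; exact: (integrableZl _ r fi). Qed.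

Lemma integrable_EFin_cst (r : R) :
  P.-integrable [set: T] (EFin \o (fun=> r)).
Proof. exact: finite_measure_integrable_cst. Qed.

Lemma Rintegral_sum (f : nat -> T -> R) n :
  (forall i, P.-integrable [set: T] (EFin \o f i)) ->
  \int[P]_t (\sum_(i < n) f i t) = \sum_(i < n) \int[P]_t f i t.
Proof.
move=> fi; elim: n => [|n IHn].
  under eq_Rintegral do rewrite big_ord0.
  by rewrite Rintegral_cst// big_ord0 mul0r.
under eq_Rintegral do rewrite big_ord_recr/=.
rewrite RintegralD//; last exact: integrable_EFin_sum.
by rewrite IHn big_ord_recr.
Qed.

Lemma Rintegral_probability_cst (r : R) : \int[P]_t r = r.
Proof.
rewrite Rintegral_cst// -[RHS]mulr1; congr (_ * _).
exact: (congr1 fine (@probability_setT _ _ _ P)).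
Qed.

Lemma integrable_sqr_of_moment (p : R) (X : {RV P >-> R}) : 2 <= p ->
  P.-integrable [set: T] (EFin \o (fun t => `|X t| `^ p)) ->
  P.-integrable [set: T] (EFin \o (fun t => X t ^+ 2)).
Proof.
move=> p2 Xp; apply: (@le_integrable_EFin _ (fun t => 1 + `|X t| `^ p)).
- exact: measurable_funX.
- move=> t; rewrite ger0_norm ?sqr_ge0// -real_normK ?num_real//.
  have [X1|X1] := leP `|X t| 1.
    apply: (@le_trans _ _ 1); first by rewrite expr_le1.
    by rewrite lerDl powR_ge0.
  rewrite -powR_sqr// ler_wpDl// ler_powR// ltW//.
- by apply: integrable_EFinD => //; exact: integrable_EFin_cst.
Qed.

Lemma integrable_of_sqr (X : {RV P >-> R}) :
  P.-integrable [set: T] (EFin \o (fun t => X t ^+ 2)) ->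
  P.-integrable [set: T] (EFin \o X).
Proof.
move=> X2; apply: (@le_integrable_EFin _ (fun t => 1 + X t ^+ 2)) => //.
- move=> t; have := sqr_ge0 (`|X t| - 1); rewrite -(real_normK (num_real (X t))).
  by have := normr_ge0 (X t); nra.
- by apply: integrable_EFinD => //; exact: integrable_EFin_cst.
Qed.

Section IdenticallyDistributed.
Variables (w : nat -> {RV P >-> R}) (f : R -> R).
Hypotheses (w_id : identically_distributed w) (mf : measurable_fun [set: R] f).
Hypothesis (fi : P.-integrable [set: T] (EFin \o (fun t => f (w 0%N t)))).

Let mEf : measurable_fun [set: R] (EFin \o f).
Proof. exact/measurable_EFinP. Qed.

Let f_law0 : (distribution P (w 0%N)).-integrable [set: R] (EFin \o f).
Proof. by apply: integrable_pushforward => //; rewrite preimage_setT. Qed.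

Lemma integrable_identically_distributed n :
  P.-integrable [set: T] (EFin \o (fun t => f (w n t))).
Proof.
apply/integrableP; split.
  by apply/measurable_EFinP; exact: measurableT_comp.
have /integrableP[_] := f_law0.
rewrite (eq_measure_integral (distribution P (w n))); last first.
  by move=> A mA _; exact: w_id.
rewrite ge0_integral_pushforward ?preimage_setT//.
exact: measurableT_comp.
Qed.

Lemma Rintegral_identically_distributed n :
  \int[P]_t f (w n t) = \int[P]_t f (w 0%N t).
Proof.
rewrite /Rintegral; congr fine.
have E i : P.-integrable [set: T] (EFin \o (fun t => f (w i t))) ->
    (\int[P]_t (f (w i t))%:E = \int[distribution P (w i)]_x (f x)%:E)%E.
  by move=> h; rewrite integral_pushforward ?preimage_setT.
rewrite (E n) ?(E 0%N)//; last exact: integrable_identically_distributed.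
by apply: eq_measure_integral => A mA _; exact: w_id.
Qed.

End IdenticallyDistributed.
End RealIntegrals.

Lemma limn_esup_le (R : realType) (u : (\bar R)^nat) (M : \bar R) :
  (\forall n \near \oo, (u n <= M)%E) -> (limn_esup u <= M)%E.
Proof.
move=> [N _ uM]; rewrite limn_esup_lim; apply: lime_le.
  exact: is_cvg_esups.
exists N => // n /= Nn; apply: ge_ereal_sup => _ [i /= ni <-].
by apply: uM; exact: leq_trans ni.
Qed.

(** * Average cost of the zooming scheme *)

Section ExcessConstant.
Context {d : measure_display} {T : measurableType d} {R : realType}.
Variables (P : probability T R) (w : nat -> {RV P >-> R}) (a p : R).

(** The 2 sums the halving of the energy, [a ^+ 2] comes from the dynamics, and the next factor from
    [sqr_residual_le]. The parenthesis collects the coefficients of the mean forcing, and the final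
    1 pays for the initial transient. *)
Definition excess_const : R :=
  2 * a ^+ 2 * (1 + (granular_const a p)^-1) *
  (2 `^ p * \int[P]_t `|w 0%N t| `^ p + 8 * granular_const a p) + 1.

Lemma excess_const_gt0 : 1 <= `|a| -> 0 < excess_const.
Proof.
move=> a1; have c_ge0 := ltW (granular_const_gt0 p a1).
rewrite ltr_wpDl// mulr_ge0//.
  by rewrite mulr_ge0 ?addr_ge0 ?invr_ge0// mulr_ge0// sqr_ge0.
rewrite addr_ge0 ?mulr_ge0 ?powR_ge0//.
by apply: Rintegral_ge0 => *; exact: powR_ge0.
Qed.

End ExcessConstant.

Section ZoomCost.
Context {d : measure_display} {T : measurableType d} {R : realType}.
Variables (P : probability T R) (x0 : {RV P >-> R}) (w : nat -> {RV P >-> R}).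
Variables (k : nat) (a b p l0 K : R).
Hypotheses (x0w : independent_of_process x0 w) (w_iid : iid w).
Hypothesis w_moment : P.-integrable [set: T] (EFin \o (fun t => `|w 0%N t| `^ p)).
Hypothesis x0_moment : P.-integrable [set: T] (EFin \o (fun t => `|x0 t| `^ p)).
Hypothesis w_mean : \int[P]_t w 0%N t = 0.
Hypotheses (k0 : (0 < k)%N) (p2 : 2 <= p) (l0_gt0 : 0 < l0) (K1 : 1 <= K).
Hypotheses (a1 : 1 <= `|a|) (b0 : b != 0).
Hypothesis K_large : 2 `^ p * `|a| `^ p * K `^ (2 - p) <= 4^-1.
Hypothesis k_large : 16 * granular_const a p * K ^+ 2 <= k%:R ^+ 2.

Let x n (t : T) : R := state a b (zoom k a b l0 K) (x0 t) (fun i => w i t) n.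
Let l n (t : T) : R := zoom_range k a b l0 K (x0 t) (fun i => w i t) n.
Let e n (t : T) : R := residual k (x n t) (l n t).
Let Z n t := energy k a p (x n t) (l n t).
Let N n t := forcing k a p l0 (w n t).
Let c1 := granular_const a p.
Let c2 := 1 + c1^-1.

Let w_id : identically_distributed w. Proof. by case: w_iid. Qed.
Let w_ind : mutually_independent w. Proof. by case: w_iid. Qed.

Let c1_gt0 : 0 < c1.
Proof. exact: granular_const_gt0 p a1. Qed.

Let c2_ge0 : 0 <= c2.
Proof. by rewrite addr_ge0// invr_ge0 ltW. Qed.

Let l_ge n t : l0 <= l n t.
Proof. exact: zoom_range_ge. Qed.

Let xS n t : x n.+1 t = a * e n t + w n t.
Proof. exact: zoom_stateS. Qed.

Let Z_step n t : Z n.+1 t <= Z n t / 2 + N n t.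
Proof.
by rewrite /Z xS /l zoom_rangeS//; apply: energy_step => //; exact: l_ge.
Qed.

Let Z_ge0 n t : 0 <= Z n t.
Proof. exact: energy_ge0. Qed.

Let N_ge0 n t : 0 <= N n t.
Proof. exact: forcing_ge0. Qed.

Let Z0E t : Z 0 t = moment p (x0 t) l0 + weight k a p * l0 ^+ 2.
Proof. by rewrite /Z /l zoom_range0 /x zoom_state0. Qed.

(** Keeping [2 * Z n t] on the left closes the induction, since [Z_step] doubled reads
    [2 * Z n.+1 t <= Z n t + 2 * N n t]. *)
Let sum_Z n t :
  \sum_(i < n) Z i t + 2 * Z n t <= 2 * Z 0 t + 2 * \sum_(i < n) N i t.
Proof.
elim: n => [|n IHn]; first by rewrite !big_ord0 add0r mulr0 addr0.
rewrite !big_ord_recr/=; have := Z_step n t; lra.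
Qed.

Let e_sqr_le n t : e n t ^+ 2 <= c2 * Z n t.
Proof. exact: sqr_residual_le k0 p2 l0_gt0 K1 a1 _ _ (l_ge _ _). Qed.

Let budget n t := c2 * (2 * Z 0 t + 2 * \sum_(i < n) N i t).

Let sum_e n t : \sum_(i < n) e i t ^+ 2 <= budget n t.
Proof.
apply: (@le_trans _ _ (c2 * \sum_(i < n) Z i t)).
  by rewrite mulr_sumr; apply: ler_sum => i _; exact: e_sqr_le.
rewrite ler_wpM2l//; apply: le_trans (sum_Z n t).
by rewrite lerDl mulr_ge0.
Qed.

(** State and range at time [i] involve only noises before [i]; this causality makes [e n]
    independent of [w n]. *)
Let past_state n i : (i <= n)%N ->
  measurable_fun [set: past x0 w n] (x i : past x0 w n -> R) /\
  measurable_fun [set: past x0 w n] (l i : past x0 w n -> R).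
Proof.
elim: i => [_|i IHi lt_in].
  split.
    rewrite (_ : x 0 = x0); first exact: past_measurable_init.
    by apply/funext => t; exact: zoom_state0.
  by rewrite (_ : l 0 = cst l0).
have [mx ml] := IHi (ltnW lt_in); split.
  rewrite (_ : x i.+1 = fun t => a * e i t + w i t); last first.
    by apply/funext => t; exact: xS.
  apply: measurable_funD; last exact: past_measurable_noise.
  by apply: measurable_funM => //; exact: measurable_residual.
rewrite (_ : l i.+1 = fun t => rescale k l0 K (l i t) (cell k (l i t) (x i t))).
  by apply: measurable_rescale => //; exact: measurable_cell.
by apply/funext => t; exact: zoom_rangeS.
Qed.

Let past_e n : measurable_fun [set: past x0 w n] (e n : past x0 w n -> R).
Proof. by have [mx ml] := past_state (leqnn n); exact: measurable_residual. Qed.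

Let mx n : measurable_fun [set: T] (x n).
Proof. by have [mx _] := past_state (leqnn n); exact: past_measurable mx. Qed.

Let me n : measurable_fun [set: T] (e n).
Proof. exact: past_measurable (@past_e n). Qed.

Let integrable_moment (X : {RV P >-> R}) :
  P.-integrable [set: T] (EFin \o (fun t => `|X t| `^ p)) ->
  P.-integrable [set: T] (EFin \o (fun t => moment p (X t) l0)).
Proof.
move=> iX; rewrite /moment; under eq_fun do rewrite mulrC.
exact: integrable_EFinZ.
Qed.

Let Rintegral_moment (X : {RV P >-> R}) :
  P.-integrable [set: T] (EFin \o (fun t => `|X t| `^ p)) ->
  \int[P]_t moment p (X t) l0 = (\int[P]_t `|X t| `^ p) * l0 `^ (2 - p).
Proof. by move=> iX; rewrite /moment RintegralZr. Qed.

Let mpow : measurable_fun [set: R] (fun y : R => `|y| `^ p).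
Proof. exact: (measurableT_comp (measurable_powR _)). Qed.

Let w_momentn n : P.-integrable [set: T] (EFin \o (fun t => `|w n t| `^ p)).
Proof. exact: integrable_identically_distributed w_id mpow w_moment n. Qed.

Let w_sqr n : P.-integrable [set: T] (EFin \o (fun t => w n t ^+ 2)).
Proof. exact: integrable_sqr_of_moment (w_momentn n). Qed.

Let iZ0 : P.-integrable [set: T] (EFin \o Z 0).
Proof.
rewrite (_ : Z 0 = fun t => moment p (x0 t) l0 + weight k a p * l0 ^+ 2).
  apply: integrable_EFinD; first exact: integrable_moment.
  exact: integrable_EFin_cst.
by apply/funext => t; exact: Z0E.
Qed.

Let iN n : P.-integrable [set: T] (EFin \o N n).
Proof.
rewrite /N /forcing; apply: integrable_EFinD; last exact: integrable_EFin_cst.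
exact/integrable_EFinZ/integrable_moment.
Qed.

Let EN n : \int[P]_t N n t =
  2 `^ p * ((\int[P]_t `|w 0%N t| `^ p) * l0 `^ (2 - p)) +
  2 * weight k a p * l0 ^+ 2.
Proof.
rewrite /N /forcing RintegralD//; last 2 first.
- exact/integrable_EFinZ/integrable_moment.
- exact: integrable_EFin_cst.
rewrite Rintegral_probability_cst RintegralZl//; last exact: integrable_moment.
by rewrite Rintegral_moment// (Rintegral_identically_distributed w_id mpow w_moment).
Qed.

Let ibudget n : P.-integrable [set: T] (EFin \o budget n).
Proof.
apply/integrable_EFinZ/integrable_EFinD; first exact: integrable_EFinZ.
exact/integrable_EFinZ/integrable_EFin_sum.
Qed.

Let Ebudget n : \int[P]_t budget n t =
  c2 * (2 * \int[P]_t Z 0 t + 2 * (n%:R * \int[P]_t N 0 t)).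
Proof.
have iS : P.-integrable [set: T] (EFin \o (fun t => \sum_(i < n) N i t)).
  exact: integrable_EFin_sum.
rewrite /budget RintegralZl//; last first.
  by apply: integrable_EFinD; exact: integrable_EFinZ.
rewrite RintegralD//; [|exact: integrable_EFinZ..].
rewrite !RintegralZl// Rintegral_sum//.
under eq_bigr do rewrite EN.
by rewrite sumr_const card_ord EN (mulr_natl _ n).
Qed.

Let ie n : P.-integrable [set: T] (EFin \o (fun t => e n t ^+ 2)).
Proof.
apply: (le_integrable_EFin _ _ (ibudget n.+1)); first exact: measurable_funX.
(* One squared error is bounded by the sum of all of them, hence by the integrable budget. *)
move=> t; rewrite ger0_norm ?sqr_ge0//; apply: le_trans (sum_e n.+1 t).
by rewrite big_ord_recr/= lerDr sumr_ge0// => i _; exact: sqr_ge0.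
Qed.

Let iew n : P.-integrable [set: T] (EFin \o (fun t => e n t * w n t)).
Proof.
apply: (le_integrable_EFin _ _ (integrable_EFinD (ie n) (w_sqr n))).
  exact: measurable_funM.
move=> t; rewrite normrM -(real_normK (num_real (e n t))).
rewrite -(real_normK (num_real (w n t))).
by have := sqr_ge0 (`|e n t| - `|w n t|);
  have := mulr_ge0 (normr_ge0 (e n t)) (normr_ge0 (w n t)); nra.
Qed.

Let Ew n : (\int[P]_t (w n t)%:E = 0)%E.
Proof.
have iw := integrable_of_sqr (w_sqr n).
rewrite -[LHS]fineK; last exact: integrable_fin_num.
have mid : measurable_fun [set: R] (idfun : R -> R) by exact: measurable_id.
have := Rintegral_identically_distributed w_id mid
  (integrable_of_sqr (w_sqr 0%N)) n.
by rewrite /= w_mean /Rintegral => ->.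
Qed.

Let Eew n : \int[P]_t (e n t * w n t) = 0.
Proof.
rewrite /Rintegral.
pose e' : {mfun T >-> R} := HB.pack (e n) (isMeasurableFun.Build _ _ _ _ _ (@me n)).
rewrite (@integral_mul_independent _ _ _ P e' (w n))//.
- exact: past_independent_pair (@past_e n).
- exact: integrable_of_sqr.
- exact: iew.
Qed.

Let E_xS n : \int[P]_t (x n.+1 t ^+ 2) =
  a ^+ 2 * \int[P]_t (e n t ^+ 2) + \int[P]_t (w 0%N t ^+ 2).
Proof.
transitivity (\int[P]_t (a ^+ 2 * e n t ^+ 2 +
    (2 * a * (e n t * w n t) + w n t ^+ 2))).
  by apply: eq_Rintegral => t _; rewrite xS; ring.
rewrite RintegralD//; last 2 first.
- exact: integrable_EFinZ.
- by apply: integrable_EFinD; [exact: integrable_EFinZ|exact: w_sqr].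
rewrite RintegralD//; last exact: integrable_EFinZ.
rewrite !RintegralZl// Eew mulr0 add0r; congr (_ + _).
have msq : measurable_fun [set: R] (fun y : R => y ^+ 2) by exact: exprn_measurable.
exact: (Rintegral_identically_distributed w_id msq (w_sqr 0%N)).
Qed.

Let ix n : P.-integrable [set: T] (EFin \o (fun t => x n t ^+ 2)).
Proof.
case: n => [|n].
  rewrite (_ : (fun t => _) = (fun t => x0 t ^+ 2)).
    exact: integrable_sqr_of_moment x0_moment.
  by apply/funext => t; rewrite /x zoom_state0.
rewrite (_ : (fun t => _) = (fun t => a ^+ 2 * e n t ^+ 2 +
    (2 * a * (e n t * w n t) + w n t ^+ 2))).
  apply: integrable_EFinD; first exact: integrable_EFinZ.
  by apply: integrable_EFinD; [exact: integrable_EFinZ|exact: w_sqr].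
by apply/funext => t; rewrite xS; ring.
Qed.

Let variance := \int[P]_t (w 0%N t ^+ 2).

(** The initial state is set apart; each of the [n] later states contributes the variance and
    [a ^+ 2] times a mean squared error, and the budget bounds their sum. *)
Let cost_bound n :
  \int[P]_t (\sum_(i < n.+1) x i t ^+ 2) <=
    \int[P]_t (x 0 t ^+ 2) + 2 * a ^+ 2 * c2 * \int[P]_t Z 0 t +
    n%:R * (variance + 2 * a ^+ 2 * c2 * \int[P]_t N 0 t).
Proof.
rewrite (Rintegral_sum (f := fun i t => x i t ^+ 2))// big_ord_recl/= -addrA lerD2l.
under eq_bigr do rewrite E_xS.
rewrite big_split/= sumr_const card_ord -mulr_sumr.
rewrite -(Rintegral_sum (f := fun i t => e i t ^+ 2))//.
have : \int[P]_t (\sum_(i < n) e i t ^+ 2) <= \int[P]_t budget n t.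
  apply: le_Rintegral => //.
    exact: (integrable_EFin_sum (f := fun i t => e i t ^+ 2)).
rewrite Ebudget => h; have := ler_wpM2l (sqr_ge0 a) h.
rewrite !(mulr_natl _ n) -/variance; lra.
Qed.

Lemma zoom_average_cost :
  (average_cost a b x0 w (zoom k a b l0 K) <=
   (variance + excess_const w a p * (l0 `^ (2 - p) + l0 ^+ 2 / k%:R ^+ 2))%:E)%E.
Proof.
have kR : 0 < k%:R :> R by rewrite ltr0n.
pose A0 := \int[P]_t (x 0 t ^+ 2) + 2 * a ^+ 2 * c2 * \int[P]_t Z 0 t.
pose B := variance + 2 * a ^+ 2 * c2 * \int[P]_t N 0 t.
(* A slack of the target order: it absorbs the initial cost [A0] once the horizon exceeds
   [A0 / eta]. *)
pose eta := l0 ^+ 2 / k%:R ^+ 2.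
have eta0 : 0 < eta by rewrite divr_gt0// exprn_gt0.
have A00 : 0 <= A0.
  rewrite addr_ge0 ?Rintegral_ge0//; first by move=> *; exact: sqr_ge0.
  rewrite mulr_ge0 ?Rintegral_ge0//.
  by rewrite mulr_ge0// mulr_ge0// sqr_ge0.
have B0 : 0 <= B.
  rewrite addr_ge0 ?Rintegral_ge0//; first by move=> *; exact: sqr_ge0.
  rewrite mulr_ge0 ?Rintegral_ge0//.
  by rewrite mulr_ge0// mulr_ge0// sqr_ge0.
have V0 : 0 <= \int[P]_t `|w 0%N t| `^ p.
  by apply: Rintegral_ge0 => *; exact: powR_ge0.
have le_target : B + eta <=
    variance + excess_const w a p * (l0 `^ (2 - p) + l0 ^+ 2 / k%:R ^+ 2).
  rewrite /B -/eta /excess_const EN -addrA lerD2l -/c1 -/c2.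
  have -> : 2 * weight k a p * l0 ^+ 2 = 8 * c1 * eta.
    by rewrite /weight /eta -/c1; field; rewrite gt_eqF.
  have := powR_ge0 l0 (2 - p); set q := l0 `^ _ => q0.
  have : 0 <= 2 * a ^+ 2 * c2 by rewrite mulr_ge0// mulr_ge0// sqr_ge0.
  set s := 2 * a ^+ 2 * c2 => s0.
  have := powR_ge0 2 p; set D := 2 `^ p => D0.
  move: V0; set V := \int[P]_t _ => V0.
  have eta_ge0 := ltW eta0; have c1_ge0 := ltW c1_gt0.
  (* [h1] and [h2] are the cross terms of the expanded product, which the target has in excess. *)
  have h1 : 0 <= s * (D * V * eta).
    exact: mulr_ge0 s0 (mulr_ge0 (mulr_ge0 D0 V0) eta_ge0).
  have h2 : 0 <= s * (8 * c1 * q) by rewrite mulr_ge0// mulr_ge0// mulr_ge0.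
  by lra.
apply: (@le_trans _ _ (B + eta)%:E); last by rewrite lee_fin.
apply: limn_esup_le; exists (Num.truncn (A0 / eta)).+1 => // n /= nA.
case: n nA => // n nA.
have -> : ('E_P[fun t => (\sum_(i < n.+1) x i t ^+ 2)%R] =
    (\int[P]_t (\sum_(i < n.+1) x i t ^+ 2))%:E)%E.
  rewrite unlock /Rintegral fineK//; apply: integrable_fin_num => //.
  exact: (@integrable_EFin_sum _ _ _ _ (fun i t => x i t ^+ 2)).
rewrite -EFinM lee_fin mulrC ler_pdivrMr ?ltr0n//.
apply: le_trans (cost_bound n) _; rewrite -/A0 -/B.
have : A0 <= eta * n.+1%:R.
  rewrite -ler_pdivrMl// mulrC; apply/ltW/(lt_le_trans (truncnS_gt _)).
  by rewrite ler_nat.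
rewrite -natr1; nra.
Qed.

End ZoomCost.

(** * Rates in the capacity and choice of the parameters *)

Section Asymptotics.
Context {R : realType}.

Lemma integrable_moment_lty (d : measure_display) (T : measurableType d)
    (P : probability T R) (X : {RV P >-> R}) (p : R) :
  ('E_P[(fun t => (`|X t| `^ p)%R)] < +oo)%E ->
  P.-integrable [set: T] (EFin \o (fun t => `|X t| `^ p)).
Proof.
rewrite unlock => Xp; apply/integrableP; split.
  apply/measurable_EFinP; apply: (measurableT_comp (measurable_powR _)).
  exact: measurableT_comp.
apply: le_lt_trans Xp; rewrite le_eqVlt; apply/orP; left; apply/eqP.
by apply: eq_integral => t _ /=; rewrite ger0_norm ?powR_ge0.
Qed.

Lemma growth_factor (p c : R) : 2 < p -> 0 < c ->
  exists2 K, 1 <= K & c * K `^ (2 - p) <= 4^-1.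
Proof.
move=> p2 c0; pose B := Num.max 1 (4 * c).
have B1 : 1 <= B by rewrite le_max lexx.
have Bc : 4 * c <= B by rewrite le_max lexx orbT.
(* This [K] satisfies K^(2-p) = 1/B. *)
exists (B `^ (p - 2)^-1).
  rewrite -[leLHS](powRr0 B); apply: ler_powR => //; rewrite invr_ge0; lra.
rewrite -powRrM (_ : (p - 2)^-1 * (2 - p) = -1); last by field; lra.
rewrite powR_inv1 ?ler_pdivrMr; lra.
Qed.

(** The scheme is run with the full moment order [p = beta]; its rate is at least as good as the one
    claimed for [r = beta - eps]. *)
Lemma powR2_rate (p r C : R) : 0 < r -> r <= p -> 0 <= C ->
  2 `^ (4 / p * C) / 2 `^ (2 * C) <= 2 `^ (4 / r * C) / 2 `^ (2 * C) :> R.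
Proof.
move=> r0 rp C0; rewrite ler_pM2r ?invr_gt0 ?powR_gt0//.
apply: ler_powR; first by lra.
rewrite ler_wpM2r// ler_wpM2l// lef_pV2 ?posrE//; lra.
Qed.

(** One unit is lost to the integer part and one to the overflow symbol. *)
Lemma alphabet_size_bound (C : R) (k : nat) : alphabet_size C = k.+1 ->
  2 `^ C - 2 <= k%:R.
Proof.
by rewrite /alphabet_size => Ek; have := truncnS_gt (2 `^ C : R);
  rewrite Ek -!natr1; lra.
Qed.

End Asymptotics.

Theorem mainTheorem2 (R : realType) (d : measure_display)
    (Omega : measurableType d) (P : probability Omega R)
    (a b : R) (x0 : {RV P >-> R}) (w : nat -> {RV P >-> R}) (sigma beta : R)
    (ha : 1 <= `|a|) (hb : b != 0)
    (w_iid : iid w)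
    (w_mean : ('E_P[w 0%N] = 0)%E)
    (w_variance : ('E_P[(fun omega => (w 0%N omega ^+ 2)%R)] = (sigma ^+ 2)%:E)%E)
    (w_density : has_positive_density (w 0%N))
    (hbeta : 2 < beta)
    (w_moment : ('E_P[(fun omega => (`|w 0%N omega| `^ beta)%R)] < +oo)%E)
    (x0_indep : independent_of_process x0 w)
    (x0_moment : ('E_P[(fun omega => (`|x0 omega| `^ beta)%R)] < +oo)%E) :
  forall eps : R, 0 < eps -> eps < beta - 2 ->
    exists (C0 : R) (S : forall C : R, C0 <= C -> scheme R (alphabet_size C)),
      bigO_pinfty
        (fun C hC => (average_cost a b x0 w (S C hC) - (sigma ^+ 2)%:E)%E)
        (fun C => 2 `^ (4 / (beta - eps) * C) / 2 `^ (2 * C)).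
Proof.
move=> eps eps0 eps_lt.
have a0 : 0 < `|a| by lra.
have [K K1 K_large] : exists2 K, 1 <= K &
    2 `^ beta * `|a| `^ beta * K `^ (2 - beta) <= 4^-1.
  by apply: growth_factor => //; rewrite mulr_gt0 ?powR_gt0.
(* As [1 <= Q], any [k] above [Q] satisfies [k_large], because its square is larger still. *)
pose Q := Num.max 1 (16 * granular_const a beta * K ^+ 2).
have Q1 : 1 <= Q by rewrite le_max lexx.
have Qc : 16 * granular_const a beta * K ^+ 2 <= Q by rewrite le_max lexx orbT.
have ln2 : 0 < ln 2 :> R by rewrite ln_gt0// ltr1n.
(* Chosen so that 2^C is at least Q + 4 from [C0] on; then 2^C - 2 exceeds both [Q] and half of
   2^C. *)
pose C0 : R := ln (Q + 4) / ln 2.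
have C0_ge0 : 0 <= C0 by rewrite divr_ge0 ?ln_ge0 ?(ltW ln2)//; lra.
have powC0 : 2 `^ C0 = Q + 4.
  rewrite /powR pnatr_eq0/= /C0 divfK ?(gt_eqF ln2)// lnK// posrE; lra.
pose c := excess_const w a beta.
have c_gt0 : 0 < c by exact: excess_const_gt0.
pose g (C : R) : R := 2 `^ (4 / (beta - eps) * C) / 2 `^ (2 * C).
have iw := integrable_moment_lty w_moment.
have ix := integrable_moment_lty x0_moment.
have w0 : \int[P]_t w 0%N t = 0.
  by move: w_mean; rewrite unlock /Rintegral => ->.
have w2 : \int[P]_t (w 0%N t ^+ 2) = sigma ^+ 2.
  by move: w_variance; rewrite unlock /Rintegral => ->.
have H (C : R) : C0 <= C -> exists S : scheme R (alphabet_size C),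
    (average_cost a b x0 w S <= (sigma ^+ 2 + c * (5 * g C))%:E)%E.
  move=> hC.
  have powC : Q + 4 <= 2 `^ C by rewrite -powC0; apply: ler_powR => //; lra.
  have C_ge0 : 0 <= C by lra.
  case Em : (alphabet_size C) => [|k].
    by have := truncnS_gt (2 `^ C : R); rewrite -/(alphabet_size C) Em; lra.
  have := alphabet_size_bound Em => kC.
  have kQ : Q <= k%:R by lra.
  have k2 : 2 `^ C / 2 <= k%:R by lra.
  have k_gt0 : (0 < k)%N by rewrite -(ltr_nat R); lra.
  have kR : 0 < k%:R :> R by rewrite ltr0n.
  pose l0 : R := 2 `^ (2 / beta * C).
  have l0_gt0 : 0 < l0 by rewrite powR_gt0.
  exists (zoom k a b l0 K).
  have k_large : 16 * granular_const a beta * K ^+ 2 <= k%:R ^+ 2.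
    by apply: (le_trans Qc); apply: (le_trans kQ); rewrite ler_eXnr//; lra.
  apply: le_trans (zoom_average_cost x0_indep w_iid iw ix w0 k_gt0 (ltW hbeta)
    l0_gt0 K1 ha hb K_large k_large) _.
  rewrite lee_fin w2 lerD2l ler_wpM2l ?(ltW c_gt0)//.
  have rate : 2 `^ (4 / beta * C) / 2 `^ (2 * C) <= g C.
    by apply: powR2_rate => //; lra.
  have l0E : l0 `^ (2 - beta) = 2 `^ (4 / beta * C) / 2 `^ (2 * C).
    rewrite /l0 -powRrM -powRN -powRD; last by rewrite pnatr_eq0 implybT.
    by congr (_ `^ _); field; lra.
  have l0_sqr : l0 ^+ 2 = 2 `^ (4 / beta * C).
    rewrite -powR_sqr ?powR_ge0// /l0 -powRrM; congr (_ `^ _); ring.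
  have powC2 : (2 `^ C) ^+ 2 = 2 `^ (2 * C) :> R.
    by rewrite -powR_sqr ?powR_ge0// -powRrM mulrC.
  have : l0 ^+ 2 / k%:R ^+ 2 <= 4 * (2 `^ (4 / beta * C) / 2 `^ (2 * C)).
    rewrite l0_sqr [leRHS]mulrCA ler_wpM2l ?powR_ge0//.
    rewrite -[leRHS]invrK lef_pV2 ?posrE ?exprn_gt0 ?invr_gt0 ?divr_gt0 ?powR_gt0//.
    rewrite -powC2 (_ : (4 / (2 `^ C) ^+ 2)^-1 = (2 `^ C / 2) ^+ 2); last first.
      by field; rewrite gt_eqF ?powR_gt0.
    by rewrite lerXn2r ?nnegrE// ?divr_ge0 ?powR_ge0// ltW.
  by rewrite l0E; lra.
exists C0, (fun C hC => sval (cid (H C hC))).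
exists (c * 5); first by rewrite mulr_gt0.
apply: nearW => C hC; case: cid => S /= HS.
by rewrite EFinN leeBlDr// -EFinD addrC -mulrA.
Qed.
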